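(* In the antithesis translation, a partial order on an $\mathfrak L$-set $A$ consists of two $\mathfrak I$-relations $\le$ and $<$ on $A$ such that \begin{align*} &\vdash_{x:A}(x\le x)\\ (x\le y)\wedge(y\le z)&\vdash_{x,y,z:A}(x\le z)\\ (x\le y)\wedge(y\le x)&\vdash_{x,y:A}(x=y)\\ (x<y)\wedge(y\le z)&\vdash_{x,y,z:A}(x<z)\\ (x\le y)\wedge(y<z)&\vdash_{x,y,z:A}(x<z)\\ (x<y)&\vdash_{x,y:A}(x\neq y)\\ (x\neq y)&\vdash_{x,y:A}((x<y)\vee(y<x)). \end{align*} That is, $\le$ is an $\mathfrak I$-partial-order, $<$ is a ''bimodule'' over it, and for $x,y:A$ we have $(x\neq y)\equiv((x<y)\vee(y<x))$. Moreover, the $\mathfrak L$-partial-order is: \begin{itemize} \item strong if and only if $<$ is cotransitive: $(x<z)\vdash(x<y)\vee(y<z)$; \item linear if and only if $(x<y)\to(x\le y)$ (hence $<$ is transitive); \item total if and only if $\le$ is total: $(x\le y)\vee(y\le x)$. \end{itemize}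
   Context: Intuitionistic ($\mathfrak I$-) side. We work in intuitionistic predicate logic over types. An $\mathfrak I$-set is a type with an equivalence relation $=$; $\mathfrak I$-relations are predicates respecting $=$. Antithesis translation. An affine ($\mathfrak L$-) predicate on a type is interpreted as a pair $P=(P^+,P^-)$ of intuitionistic predicates with $\neg(P^+\wedge P^-)$ (pointwise). Types and terms are unchanged. $P\vdash Q$ means both $P^+\vdash Q^+$ and $Q^-\vdash P^-$; $\vdash Q$ means $\top\vdash Q$, $\top=(\mathbf 1,\mathbf 0)$ (true, false). Connectives: $$P\boxtimes Q=(P^+\wedge Q^+,(P^+\to Q^-)\wedge(Q^+\to P^-)),\qquad P\sqcap Q=(P^+\wedge Q^+,P^-\vee Q^-),$$ $$P\sqcup Q=(P^+\vee Q^+,P^-\wedge Q^-),\qquad P\odot Q=((P^-\to Q^+)\wedge(Q^-\to P^+),P^-\wedge Q^-)$$ ($\odot$ denotes the multiplicative disjunction, ''par''). An $\mathfrak L$-set is a type $A$ with an $\mathfrak L$-predicate $\circeq$ on $A\times A$ with $\vdash x\circeq x$, $x\circeq y\vdash y\circeq x$, $(x\circeq y)\boxtimes(y\circeq z)\vdash x\circeq z$. Writing $(x\circeq y)=((x=y),(x\neq y))$, it is an $\mathfrak I$-set with an irreflexive symmetric relation $\neq$. An $\mathfrak L$-relation on an $\mathfrak L$-set $B$ is an $\mathfrak L$-predicate $R$ with $(b\circeq b')\boxtimes R(b)\vdash R(b')$. The tensor product $A\boxtimes A$ is the $\mathfrak L$-set on the type $A\times A$ with equality $(x_1\circeq x_2)\boxtimes(y_1\circeq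 y_2)$. An $\mathfrak L$-preorder on a type $A$ is an $\mathfrak L$-predicate $\sqsubseteq$ on $A\times A$ with $\vdash x\sqsubseteq x$ and $(x\sqsubseteq y)\boxtimes(y\sqsubseteq z)\vdash x\sqsubseteq z$. It is strong if $(x\sqsubseteq y)\sqcap(y\sqsubseteq z)\vdash x\sqsubseteq z$; linear if $\vdash(x\sqsubseteq y)\odot(y\sqsubseteq x)$; total if $\vdash(x\sqsubseteq y)\sqcup(y\sqsubseteq x)$. A partial order on an $\mathfrak L$-set $A$ is a preorder $\sqsubseteq$ that is an $\mathfrak L$-relation on $A\boxtimes A$ and satisfies $(x\sqsubseteq y)\sqcap(y\sqsubseteq x)\vdash x\circeq y$. In the translation, $x\le y$ denotes the positive part of $x\sqsubseteq y$, and $x<y$ denotes the negative part of $y\sqsubseteq x$. *)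

(* Defs.v *)
(* Intuitionistic predicate logic over types is rendered by Rocq's axiom-free
   [Prop] over [Type]. *)
From Stdlib Require Import RelationClasses Morphisms.

Set Implicit Arguments.
Unset Strict Implicit.
Local Obligation Tactic := idtac.

(* An affine predicate on a type [T] is a function [T -> Lprop]; a judgment in
   a context of variables is a universally quantified [entails] or [holds]. *)
Record Lprop : Type := MkLprop {
  pos : Prop;
  neg : Prop;
  pos_neg : ~ (pos /\ neg)
}.

Definition entails (P Q : Lprop) : Prop :=
  (pos P -> pos Q) /\ (neg Q -> neg P).

Definition Ltop : Lprop := @MkLprop True False (fun h => proj2 h).

Definition holds (Q : Lprop) : Prop := entails Ltop Q.

(* [Ltensor], [Lmeet], [Ljoin], [Lpar] are the connectives written boxtimes,
   sqcap, sqcup and odot. *)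
Program Definition Ltensor (P Q : Lprop) : Lprop :=
  @MkLprop (pos P /\ pos Q)
           ((pos P -> neg Q) /\ (pos Q -> neg P)) _.
Next Obligation.
  intros P Q [[p q] [h _]]; exact (pos_neg (conj q (h p))).
Qed.

Program Definition Lmeet (P Q : Lprop) : Lprop :=
  @MkLprop (pos P /\ pos Q) (neg P \/ neg Q) _.
Next Obligation.
  intros P Q [[p q] [np | nq]];
    [exact (pos_neg (conj p np)) | exact (pos_neg (conj q nq))].
Qed.

Program Definition Ljoin (P Q : Lprop) : Lprop :=
  @MkLprop (pos P \/ pos Q) (neg P /\ neg Q) _.
Next Obligation.
  intros P Q [[p | q] [np nq]];
    [exact (pos_neg (conj p np)) | exact (pos_neg (conj q nq))].
Qed.

Program Definition Lpar (P Q : Lprop) : Lprop :=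
  @MkLprop ((neg P -> pos Q) /\ (neg Q -> pos P))
           (neg P /\ neg Q) _.
Next Obligation.
  intros P Q [[h _] [np nq]]; exact (pos_neg (conj (h np) nq)).
Qed.

Record Lset : Type := MkLset {
  carrier :> Type;
  Leq : carrier -> carrier -> Lprop;
  Leq_refl : forall x, holds (Leq x x);
  Leq_sym : forall x y, entails (Leq x y) (Leq y x);
  Leq_trans : forall x y z, entails (Ltensor (Leq x y) (Leq y z)) (Leq x z)
}.

Definition Lrelation (B : Lset) (R : B -> Lprop) : Prop :=
  forall b b' : B, entails (Ltensor (Leq b b') (R b)) (R b').

Lemma entails_trans P Q S : entails P Q -> entails Q S -> entails P S.
Proof. unfold entails; tauto. Qed.

Lemma Ltensor_mono P P' Q Q' :
  entails P P' -> entails Q Q' -> entails (Ltensor P Q) (Ltensor P' Q').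
Proof. unfold entails; simpl; tauto. Qed.

Lemma Ltensor_swap P Q P' Q' :
  entails (Ltensor (Ltensor P Q) (Ltensor P' Q'))
          (Ltensor (Ltensor P P') (Ltensor Q Q')).
Proof. unfold entails; simpl; tauto. Qed.

Program Definition Lset_tensor (A B : Lset) : Lset :=
  @MkLset (A * B)%type
          (fun p q => Ltensor (Leq (fst p) (fst q)) (Leq (snd p) (snd q)))
          _ _ _.
Next Obligation.
  intros A B [x y].
  destruct (Leq_refl x) as [p n], (Leq_refl y) as [p' n'].
  unfold holds, entails in *; simpl in *; tauto.
Qed.
Next Obligation.
  intros A B p q; apply Ltensor_mono; apply Leq_sym.
Qed.
Next Obligation.
  intros A B p q r.
  eapply entails_trans; [apply Ltensor_swap |].
  apply Ltensor_mono; apply Leq_trans.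
Qed.

Definition Ieq (A : Lset) : A -> A -> Prop := fun x y => pos (Leq x y).
Definition Ineq (A : Lset) : A -> A -> Prop := fun x y => neg (Leq x y).

Global Instance Ieq_equivalence (A : Lset) : Equivalence (@Ieq A).
Proof.
  split.
  - intros x; exact (proj1 (Leq_refl x) I).
  - intros x y; exact (proj1 (Leq_sym x y)).
  - intros x y z h k; exact (proj1 (Leq_trans x y z) (conj h k)).
Qed.

Definition Irelation2 (A : Lset) (S : A -> A -> Prop) : Prop :=
  Proper (@Ieq A ==> @Ieq A ==> iff)%signature S.

Definition Lpreorder (A : Type) (R : A -> A -> Lprop) : Prop :=
  (forall x, holds (R x x)) /\
  (forall x y z, entails (Ltensor (R x y) (R y z)) (R x z)).

Definition Lstrong (A : Type) (R : A -> A -> Lprop) : Prop :=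
  forall x y z, entails (Lmeet (R x y) (R y z)) (R x z).

Definition Llinear (A : Type) (R : A -> A -> Lprop) : Prop :=
  forall x y, holds (Lpar (R x y) (R y x)).

Definition Ltotal (A : Type) (R : A -> A -> Lprop) : Prop :=
  forall x y, holds (Ljoin (R x y) (R y x)).

Definition Lpartial_order (A : Lset) (R : A -> A -> Lprop) : Prop :=
  Lpreorder R /\
  Lrelation (B := Lset_tensor A A) (fun p => R (fst p) (snd p)) /\
  (forall x y, entails (Lmeet (R x y) (R y x)) (Leq x y)).

(* [x < y] is the negative part of [R y x]: the arguments are swapped. *)
Definition le_of (A : Type) (R : A -> A -> Lprop) : A -> A -> Prop :=
  fun x y => pos (R x y).
Definition lt_of (A : Type) (R : A -> A -> Lprop) : A -> A -> Prop :=
  fun x y => neg (R y x).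

Record order_pair (A : Lset) (le lt : A -> A -> Prop) : Prop := MkOrderPair {
  op_le_rel : Irelation2 le;
  op_lt_rel : Irelation2 lt;
  op_le_refl : forall x, le x x;
  op_le_trans : forall x y z, le x y /\ le y z -> le x z;
  op_le_antisym : forall x y, le x y /\ le y x -> Ieq x y;
  op_lt_le : forall x y z, lt x y /\ le y z -> lt x z;
  op_le_lt : forall x y z, le x y /\ lt y z -> lt x z;
  op_lt_neq : forall x y, lt x y -> Ineq x y;
  op_neq_lt : forall x y, Ineq x y -> lt x y \/ lt y x
}.

Definition Ipartial_order (A : Lset) (le : A -> A -> Prop) : Prop :=
  Irelation2 le /\ PreOrder le /\ Antisymmetric A (@Ieq A) le.

Definition Ibimodule (A : Lset) (le lt : A -> A -> Prop) : Prop :=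
  Irelation2 lt /\
  (forall x y z, lt x y /\ le y z -> lt x z) /\
  (forall x y z, le x y /\ lt y z -> lt x z).

Definition cotransitive (A : Type) (lt : A -> A -> Prop) : Prop :=
  forall x y z, lt x z -> lt x y \/ lt y z.

(* Main.v *)
Require Import Defs.
From Stdlib Require Import RelationClasses.

(** Every affine entailment [P |- Q] carries a second, contrapositive one,
    [neg Q -> neg P]; the listed axioms are what the axioms of an affine
    partial order say once both halves are read off, with [x < y] standing for
    the negative part of [R y x].

    The positive halves give reflexivity, transitivity and antisymmetry of
    [<=].  The contrapositive of transitivity, through the multiplicative
    conjunction, gives the two bimodule laws; that of antisymmetry, through the
    additive conjunction, turns [Ineq x y] into [x < y \/ y < x].  The remaining
    axiom [x < y -> Ineq x y] comes from the contrapositive of substitutivity: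
    comparing the valid [R x x] with the refuted [R y x] refutes the equality
    of the pairs [(x, x)] and [(y, x)], hence of [x] and [y].  Conversely, the
    contrapositive of substitutivity follows from the bimodule laws together
    with [x < y -> Ineq x y], and [<=] and [>] are incompatible because a
    bimodule law would produce some [x < x], hence [Ineq x x]; this
    incompatibility is what lets a pair of relations be assembled into an affine predicate.

    Strength, linearity and totality each have one half that is the stated
    condition on [<] or [<=]; the other half is then automatic. *)

Section OrderPairs.

Variable A : Lset.

Lemma Ineq_irrefl (x : A) : ~ Ineq x x.
Proof. exact (proj2 (Leq_refl x)). Qed.

Lemma Ineq_sym (x y : A) : Ineq x y -> Ineq y x.
Proof. exact (proj2 (Leq_sym y x)). Qed.

Lemma Irelation2_intro (S : A -> A -> Prop) :
  (forall x x' y y', Ieq x x' -> Ieq y y' -> S x y -> S x' y') ->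
  Irelation2 S.
Proof.
  intros HS x x' ex y y' ey; split.
  - exact (HS x x' y y' ex ey).
  - apply HS; symmetry; assumption.
Qed.

(** Transporting the refutation of [R x' y'] back along the equalities uses the
    first component of the refutation of a multiplicative conjunction. *)
Lemma Lrelation_lt_rel (R : A -> A -> Lprop) :
  Lrelation (B := Lset_tensor A A) (fun p => R (fst p) (snd p)) ->
  Irelation2 (lt_of R).
Proof.
  intros Hrel; apply Irelation2_intro; intros x x' y y' ex ey.
  refine (fun h => proj1 (proj2 (Hrel (y', x') (y, x)) h) _).
  split; symmetry; assumption.
Qed.

(** Substitutivity is played against reflexivity: [R x x] holds while [R y x]
    is refuted, so the second component of the refutation of a multiplicative
    conjunction refutes the equality of [(x, x)] and [(y, x)]. *)
Lemma Lrelation_lt_neq (R : A -> A -> Lprop) :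
  (forall x, holds (R x x)) ->
  Lrelation (B := Lset_tensor A A) (fun p => R (fst p) (snd p)) ->
  forall x y, lt_of R x y -> Ineq x y.
Proof.
  intros Hrefl Hrel x y h.
  destruct (proj2 (Hrel (x, x) (y, x)) h) as [_ Hneq].
  destruct (Hneq (proj1 (Hrefl x) I)) as [_ Hfst].
  apply Hfst; exact (reflexivity (R := @Ieq A) x).
Qed.

Lemma Lpartial_order_order_pair (R : A -> A -> Lprop) :
  Lpartial_order R -> order_pair (le_of R) (lt_of R).
Proof.
  intros [[Hrefl Htrans] [Hrel Hanti]]; split.
  - apply Irelation2_intro; intros x x' y y' ex ey h.
    exact (proj1 (Hrel (x, y) (x', y')) (conj (conj ex ey) h)).
  - exact (Lrelation_lt_rel R Hrel).
  - intros x; exact (proj1 (Hrefl x) I).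
  - intros x y z; exact (proj1 (Htrans x y z)).
  - intros x y; exact (proj1 (Hanti x y)).
  - intros x y z [h k]; exact (proj1 (proj2 (Htrans y z x) h) k).
  - intros x y z [h k]; exact (proj2 (proj2 (Htrans z x y) k) h).
  - exact (Lrelation_lt_neq R Hrefl Hrel).
  - intros x y h.
    destruct (proj2 (Hanti x y) h); [right | left]; assumption.
Qed.

Section Laws.

Variables le lt : A -> A -> Prop.
Hypothesis H : order_pair le lt.

Lemma order_pair_lt_irrefl (x : A) : ~ lt x x.
Proof. intros h; exact (Ineq_irrefl x (op_lt_neq H h)). Qed.

(** The incompatibility of positive and negative parts required of an affine
    predicate. *)
Lemma order_pair_le_lt_excl (x y : A) : ~ (le x y /\ lt y x).
Proof.
  intros [h k]; exact (order_pair_lt_irrefl x (op_le_lt H (conj h k))).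
Qed.

End Laws.

(** The contrapositive half of substitutivity is the one with content.  If
    [x <= y] but [y' < x'], then [x = x'] gives [y' < x <= y] and [y = y']
    gives [x <= y < x'], so in either case [Ineq] holds of the other
    coordinates. *)
Lemma order_pair_Lpartial_order (R : A -> A -> Lprop) :
  order_pair (le_of R) (lt_of R) -> Lpartial_order R.
Proof.
  intros H; split; [split | split].
  - intros x; split.
    + intros _; exact (op_le_refl H x).
    + exact (order_pair_lt_irrefl _ _ H x).
  - intros x y z; split.
    + exact (op_le_trans H (x := x) (y := y) (z := z)).
    + intros h; split; intros k.
      * exact (op_lt_le H (conj h k)).
      * exact (op_le_lt H (conj k h)).
  - intros [x y] [x' y']; split.
    + intros [[ex ey] h].
      exact (proj1 (op_le_rel H ex ey) h).
    + simpl; intros h; split.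
      * intros [ex ey].
        exact (proj2 (op_lt_rel H ey ex) h).
      * intros k; split; intros e.
        -- apply Ineq_sym, (op_lt_neq H).
           apply (op_lt_le H (y := x)); split; [| exact k].
           exact (proj2 (op_lt_rel H (reflexivity y') e) h).
        -- apply (op_lt_neq H).
           apply (op_le_lt H (y := y)); split; [exact k |].
           exact (proj2 (op_lt_rel H e (reflexivity x')) h).
  - intros x y; split.
    + exact (op_le_antisym H (x := x) (y := y)).
    + intros h; destruct (op_neq_lt H h); [right | left]; assumption.
Qed.

(** [lt] enters with its arguments swapped, so that [lt_of] of the result is
    [lt] again up to conversion. *)
Definition order_pair_Lprop (le lt : A -> A -> Prop) (H : order_pair le lt)
    (x y : A) : Lprop :=
  @MkLprop (le x y) (lt y x) (order_pair_le_lt_excl le lt H x y).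

(** The symmetry of [Ineq] supplies the disjunct [y < x] of the equivalence; the
    other ingredients are regroupings. *)
Lemma order_pair_bimodule (le lt : A -> A -> Prop) :
  order_pair le lt <->
  Ipartial_order le /\ Ibimodule le lt /\
  (forall x y, Ineq x y <-> lt x y \/ lt y x).
Proof.
  split.
  - intros H; split; [| split].
    + split; [exact (op_le_rel H) | split; [split |]].
      * exact (op_le_refl H).
      * intros x y z h k; exact (op_le_trans H (conj h k)).
      * intros x y h k; exact (op_le_antisym H (conj h k)).
    + exact (conj (op_lt_rel H) (conj (op_lt_le H) (op_le_lt H))).
    + intros x y; split; [exact (op_neq_lt H (x := x) (y := y)) |].
      intros [h | h]; [| apply Ineq_sym]; exact (op_lt_neq H h).
  - intros [[Hle [Hpre Hanti]] [[Hlt [Hltle Hlelt]] Hneq]]; split.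
    + exact Hle.
    + exact Hlt.
    + intros x; reflexivity.
    + intros x y z [h k]; transitivity y; assumption.
    + intros x y [h k]; exact (Hanti x y h k).
    + exact Hltle.
    + exact Hlelt.
    + intros x y h; apply Hneq; left; exact h.
    + intros x y; apply Hneq.
Qed.

End OrderPairs.

Lemma Lstrong_iff_cotransitive (A : Lset) (R : A -> A -> Lprop) :
  Lpartial_order R -> Lstrong R <-> cotransitive (lt_of R).
Proof.
  intros HR; split.
  - intros Hs x y z h.
    destruct (proj2 (Hs z y x) h); [right | left]; assumption.
  - intros Hc x y z; split.
    + exact (proj1 (proj2 (proj1 HR) x y z)).
    + intros h; destruct (Hc z y x h); [right | left]; assumption.
Qed.

(** Once [<] implies [<=], the contrapositive half holds because [x < y] and
    [y < x] would make [R x y] both valid and refuted. *)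
Lemma Llinear_iff_lt_le (A : Type) (R : A -> A -> Lprop) :
  Llinear R <-> (forall x y, lt_of R x y -> le_of R x y).
Proof.
  split.
  - intros Hl x y; exact (proj2 (proj1 (Hl x y) I)).
  - intros Hlt x y; split.
    + intros _; split; apply Hlt.
    + intros [h k]; exact (pos_neg (conj (Hlt x y k) h)).
Qed.

Lemma Ltotal_iff_le_total (A : Type) (R : A -> A -> Lprop) :
  Ltotal R <-> (forall x y, le_of R x y \/ le_of R y x).
Proof.
  split.
  - intros Ht x y; exact (proj1 (Ht x y) I).
  - intros Ht x y; split.
    + intros _; apply Ht.
    + intros [h k]; destruct (Ht x y) as [p | p].
      * exact (pos_neg (conj p h)).
      * exact (pos_neg (conj p k)).
Qed.

Theorem theorem8p3 (A : Lset) :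
  (forall R : A -> A -> Lprop,
     Lpartial_order R <-> order_pair (le_of R) (lt_of R)) /\
  (forall le lt : A -> A -> Prop, order_pair le lt ->
     exists R : A -> A -> Lprop,
       Lpartial_order R /\ le_of R = le /\ lt_of R = lt /\
       (forall R' : A -> A -> Lprop,
          (forall x y, le_of R' x y <-> le x y) ->
          (forall x y, lt_of R' x y <-> lt x y) ->
          forall x y, entails (R' x y) (R x y) /\ entails (R x y) (R' x y))) /\
  (forall le lt : A -> A -> Prop,
     order_pair le lt <->
     Ipartial_order le /\ Ibimodule le lt /\
     (forall x y, Ineq x y <-> lt x y \/ lt y x)) /\
  (forall R : A -> A -> Lprop, Lpartial_order R ->
     (Lstrong R <-> cotransitive (lt_of R)) /\
     (Llinear R <-> (forall x y, lt_of R x y -> le_of R x y)) /\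
     (Llinear R -> Transitive (lt_of R)) /\
     (Ltotal R <-> (forall x y, le_of R x y \/ le_of R y x))).
Proof.
  split; [| split; [| split]].
  - intros R; split.
    + apply Lpartial_order_order_pair.
    + apply order_pair_Lpartial_order.
  - intros le lt H; exists (order_pair_Lprop A le lt H).
    split; [| split; [| split]].
    + apply order_pair_Lpartial_order; exact H.
    + reflexivity.
    + reflexivity.
    + intros R' Hle Hlt x y; split; split.
      * apply Hle.
      * apply Hlt.
      * apply Hle.
      * apply Hlt.
  - apply order_pair_bimodule.
  - intros R HR; split; [| split; [| split]].
    + exact (Lstrong_iff_cotransitive A R HR).
    + apply Llinear_iff_lt_le.
    + intros Hl x y z h k.
      apply (op_lt_le (Lpartial_order_order_pair A R HR) (y := y)).
      split; [exact h | exact (proj1 (Llinear_iff_lt_le A R) Hl y z k)].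
    + apply Ltotal_iff_le_total.
Qed.
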